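(* Let $R$ be a local commutative ring which is not a field. The following assertions are equivalent: (1) $R$ is $2$-semiregular; (2) every finitely presented cyclic $R$-module is $2$-periodic; (3) $R$ is a valuation semiregular ring (i.e. both a valuation ring and a semiregular ring); (4) $R$ is a valuation ring and there exists $0\neq a\in R$ such that $(0:a)$ is nonzero and finitely generated; (5) $R$ is a Bézout ring and its maximal ideal $P$ is not flat.
   Context: All rings are commutative with identity and all modules are unitary. Local means having a unique maximal ideal (no Noetherian hypothesis). An $R$-module $M$ is $2$-periodic if there is an exact sequence $0\to M\to P_2\to P_1\to M\to 0$ with $P_1,P_2$ projective; $R$ is $2$-semiregular if every finitely presented $R$-module is $2$-periodic. $R$ is semiregular if every $R$-module embeds into a flat $R$-module. $R$ is a valuation ring if its ideals are totally ordered by inclusion (zero divisors are allowed). $R$ is Bézout if every finitely generated ideal is principal. For $a\in R$, $(0:a)=\{r\in R: ra=0\}$. *)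

(* Defs.v *)
From HB Require Import structures.
From mathcomp Require Import all_boot all_algebra.
From mathcomp.multinomials Require Import freeg.
From mathcomp.classical Require Import boolp.

Set Implicit Arguments.
Unset Strict Implicit.
Unset Printing Implicit Defensive.

Import GRing.Theory.
Local Open Scope ring_scope.
Local Open Scope quotient_scope.

(* An ideal of R is a submodule of the regular module R^o, i.e. an element of *)
(* submodClosed R^o.  Submodules are boolean predicates; since boolp turns    *)
(* any Prop into a bool, these are all the submodules.  Likewise the          *)
(* choiceType structure carried by every lmodType is no restriction.          *)

Section Submodule.
Variables (R : comNzRingType) (V : lmodType R) (S : submodClosed V).

Record submod_of := Submod { submod_val :> V; submod_valP : submod_val \in S }.

HB.instance Definition _ := [isSub for submod_val].
HB.instance Definition _ := [Choice of submod_of by <:].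
HB.instance Definition _ := [SubChoice_isSubLmodule of submod_of by <:].

(* submodClosed is stated for semimodules, so S alone is not a zmodClosed.    *)
Definition submod_pred : {pred V} := fun x => x \in S.

Lemma submod_pred_closed : submod_closed submod_pred.
Proof. exact: submodClosedP. Qed.

HB.instance Definition _ :=
  GRing.isSubmodClosed.Build R V submod_pred submod_pred_closed.

End Submodule.

(* MathComp only equips the quotient by a submodule with a zmodType structure. *)
Section QuotientModule.
Variables (R : comNzRingType) (V : lmodType R) (S : submodClosed V).

Definition quot_mod : Type := Quotient.quot (submod_pred S).

HB.instance Definition _ := GRing.Zmodule.on quot_mod.
HB.instance Definition _ := EqQuotient.on quot_mod.

Definition quot_pi (v : V) : quot_mod := \pi_(Quotient.quot (submod_pred S)) v.

Lemma quot_piP u v : quot_pi u = quot_pi v <-> u - v \in S.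
Proof.
have -> : (u - v \in S) = (u == v %[mod Quotient.quot (submod_pred S)]).
  by rewrite -Quotient.idealrBE.
by split=> [/eqP|/eqP].
Qed.

Lemma quot_piK (x : quot_mod) : quot_pi (repr (x : Quotient.quot (submod_pred S))) = x.
Proof. exact: reprK. Qed.

Lemma quot_piD : {morph quot_pi : u v / u + v}.
Proof. by move=> u v; apply: (raddfD \pi_(Quotient.quot (submod_pred S))). Qed.

Definition quot_scale (c : R) (x : quot_mod) : quot_mod :=
  quot_pi (c *: repr (x : Quotient.quot (submod_pred S))).

Lemma quot_scaleE c v : quot_scale c (quot_pi v) = quot_pi (c *: v).
Proof.
by apply/quot_piP; rewrite -scalerBr rpredZ //; apply/quot_piP; rewrite quot_piK.
Qed.

Lemma quot_scaleA a b x : quot_scale a (quot_scale b x) = quot_scale (a * b) x.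
Proof. by rewrite -[x]quot_piK !quot_scaleE scalerA. Qed.

Lemma quot_scale1 : left_id 1 quot_scale.
Proof. by move=> x; rewrite -[x]quot_piK quot_scaleE scale1r. Qed.

Lemma quot_scaleDr : right_distributive quot_scale +%R.
Proof.
move=> c x y; rewrite -[x]quot_piK -[y]quot_piK.
by rewrite !(quot_scaleE, =^~ quot_piD) scalerDr.
Qed.

Lemma quot_scaleDl x : {morph quot_scale^~ x : a b / a + b}.
Proof.
by move=> a b; rewrite -[x]quot_piK !quot_scaleE -quot_piD scalerDl.
Qed.

HB.instance Definition _ := GRing.Zmodule_isLmodule.Build R quot_mod
  quot_scaleA quot_scale1 quot_scaleDr quot_scaleDl.

Lemma quot_pi_is_linear : linear quot_pi.
Proof. by move=> c u v; rewrite quot_piD -quot_scaleE. Qed.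

HB.instance Definition _ :=
  GRing.isLinear.Build R V quot_mod _ quot_pi quot_pi_is_linear.

End QuotientModule.

(* M (x)_R N: the free module on M * N modulo the submodule generated by the  *)
(* bilinearity relations.                                                     *)
Section TensorProduct.
Variables (R : comNzRingType) (M N : lmodType R).

Definition pair_mod : lmodType R := {freeg (M * N)%type / R}.

Definition pure (x : M) (y : N) : pair_mod := Freeg [:: (1, (x, y))].

Definition bilinear_relations (S : {pred pair_mod}) : Prop :=
  (forall c x x' y, pure (c *: x + x') y - (c *: pure x y + pure x' y) \in S) /\
  (forall c x y y', pure x (c *: y + y') - (c *: pure x y + pure x y') \in S).

Definition tensor_rel : {pred pair_mod} := fun u =>
  `[< forall S : submodClosed pair_mod, bilinear_relations S -> u \in S >].

Lemma tensor_rel_closed : submod_closed tensor_rel.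
Proof.
split=> [|c u v /asboolP uP /asboolP vP]; apply/asboolP => S relS.
  exact: rpred0.
by rewrite rpredD ?rpredZ ?uP ?vP.
Qed.

HB.instance Definition _ :=
  GRing.isSubmodClosed.Build R pair_mod tensor_rel tensor_rel_closed.

Definition tensor : lmodType R := quot_mod tensor_rel.

Definition tens (x : M) (y : N) : tensor := quot_pi tensor_rel (pure x y).

Lemma tens_linearl y : linear (tens^~ y).
Proof.
move=> c x x'; rewrite /tens -linearP; apply/quot_piP/asboolP => S [relS _].
exact: relS.
Qed.

Lemma tens_linearr x : linear (tens x).
Proof.
move=> c y y'; rewrite /tens -linearP; apply/quot_piP/asboolP => S [_ relS].
exact: relS.
Qed.

(* The linear map induced by b when b is bilinear (see tensor_liftE).         *)
Definition tensor_lift (T : lmodType R) (b : M -> N -> T) (t : tensor) : T :=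
  fglift (fun p => b p.1 p.2) (repr (t : Quotient.quot (submod_pred tensor_rel))).

Section UniversalProperty.
Variables (T : lmodType R) (b : M -> N -> T).
Hypotheses (bl : forall y, linear (b^~ y)) (br : forall x, linear (b x)).

Let lift (u : pair_mod) : T := fglift (fun p => b p.1 p.2) u.

Let lift_pure x y : lift (pure x y) = b x y.
Proof. by rewrite /lift liftU scale1r. Qed.

Let lift_sub : {morph lift : u v / u - v}.
Proof. exact: lift_is_additive. Qed.

Let lift0 : lift 0 = 0.
Proof. by rewrite -[0 in LHS](subrr 0) lift_sub subrr. Qed.

Let lift_add : {morph lift : u v / u + v}.
Proof.
by move=> u v; rewrite -{1}[v]opprK -[- v]add0r !lift_sub lift0 sub0r opprK.
Qed.

Let lift_scale c u : lift (c *: u) = c *: lift u.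
Proof.
rewrite -[u in RHS]freeg_sumE [c *: u]/(fgscale c u) /fgscale.
rewrite !(big_morph lift lift_add lift0) scaler_sumr.
by apply: eq_bigr => z _; rewrite /lift !liftU scalerA.
Qed.

Let lift_ker : {pred pair_mod} := fun u => lift u == 0.

Let lift_ker_closed : submod_closed lift_ker.
Proof.
split=> [|c u v]; rewrite !unfold_in ?lift0 // => /eqP u0 /eqP v0.
by rewrite lift_add lift_scale u0 v0 scaler0 addr0.
Qed.

HB.instance Definition _ :=
  GRing.isSubmodClosed.Build R pair_mod lift_ker lift_ker_closed.

Let lift_tensor_rel u : u \in tensor_rel -> lift u = 0.
Proof.
move=> /asboolP/(_ lift_ker) u_ker; apply/eqP/u_ker; split=> [c x x' y|c x y y'].
  rewrite unfold_in lift_sub lift_add lift_scale !lift_pure.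
  by rewrite (bl y c x x') subrr.
rewrite unfold_in lift_sub lift_add lift_scale !lift_pure.
by rewrite (br x c y y') subrr.
Qed.

Let tensor_lift_pi u : tensor_lift b (quot_pi tensor_rel u) = lift u.
Proof.
apply/eqP; rewrite -subr_eq0; apply/eqP.
by rewrite -[_ b _]/(lift _) -lift_sub lift_tensor_rel //; apply/quot_piP/quot_piK.
Qed.

Lemma tensor_liftE x y : tensor_lift b (tens x y) = b x y.
Proof. by rewrite tensor_lift_pi lift_pure. Qed.

Lemma tensor_lift_linear : linear (tensor_lift b).
Proof.
move=> c t t'; rewrite -[t]quot_piK -[t']quot_piK -linearP !tensor_lift_pi.
by rewrite lift_add lift_scale.
Qed.

End UniversalProperty.

End TensorProduct.

Definition tensor_map (R : comNzRingType) (M M' F : lmodType R) (f : M -> M') :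
  tensor M F -> tensor M' F := tensor_lift (fun x y => tens (f x) y).

Lemma tensor_mapE (R : comNzRingType) (M M' F : lmodType R)
  (f : {linear M -> M'}) x y : tensor_map f (@tens R M F x y) = tens (f x) y.
Proof.
apply: (tensor_liftE (b := fun x y => tens (f x) y)) => [{}y c x1 x2|{}x c y1 y2].
  by rewrite linearP tens_linearl.
by rewrite tens_linearr.
Qed.

Section Modules.
Variable R : comNzRingType.

Definition flat (F : lmodType R) : Prop :=
  forall (M N : lmodType R) (f : {linear M -> N}),
    injective f -> injective (tensor_map (F := F) f).

Definition surj (A B : Type) (f : A -> B) : Prop := forall y, exists x, f x = y.

Definition exact_at (A B C : lmodType R) (f : A -> B) (g : B -> C) : Prop :=
  forall y, g y = 0 <-> exists x, f x = y.

Definition projective (P : lmodType R) : Prop :=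
  forall (A B : lmodType R) (g : {linear A -> B}) (f : {linear P -> B}),
    surj g -> exists h : {linear P -> A}, forall x, g (h x) = f x.

Definition finitely_presented (M : lmodType R) : Prop :=
  exists (m n : nat) (d : {linear 'rV[R]_m -> 'rV[R]_n})
         (p : {linear 'rV[R]_n -> M}),
    exact_at d p /\ surj p.

Definition cyclic_mod (M : lmodType R) : Prop :=
  exists x : M, forall y : M, exists c : R, y = c *: x.

Definition two_periodic (M : lmodType R) : Prop :=
  exists (P1 P2 : lmodType R) (i : {linear M -> P2}) (d : {linear P2 -> P1})
         (p : {linear P1 -> M}),
    [/\ projective P1 & projective P2] /\
    [/\ injective i, exact_at i d, exact_at d p & surj p].

Definition two_semiregular : Prop :=
  forall M : lmodType R, finitely_presented M -> two_periodic M.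

Definition semiregular : Prop :=
  forall M : lmodType R,
    exists2 F : lmodType R, flat F & exists f : {linear M -> F}, injective f.

End Modules.

Section Ideals.
Variable R : comNzRingType.
Implicit Types I J : submodClosed R^o.

Definition maximal_ideal I : Prop :=
  1 \notin I /\ forall J, {subset I <= J} -> 1 \notin J -> J =i I.

Definition unique_maximal_ideal I : Prop :=
  maximal_ideal I /\ forall J, maximal_ideal J -> J =i I.

Definition is_field : Prop := forall x : R, x != 0 -> exists y, y * x = 1.

Definition valuation_ring : Prop :=
  forall I J, {subset I <= J} \/ {subset J <= I}.

Definition fg_ideal I : Prop :=
  exists s : seq R, forall x : R,
    x \in I <-> exists c : 'I_(size s) -> R, x = \sum_(i < size s) c i * s`_i.

Definition principal_ideal I : Prop :=
  exists g : R, forall x : R, x \in I <-> exists c : R, x = c * g.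

Definition bezout_ring : Prop := forall I, fg_ideal I -> principal_ideal I.

Definition ann (a : R) : {pred R^o} := fun r : R => r * a == 0.

Lemma ann_closed a : submod_closed (ann a).
Proof.
split=> [|c u v]; rewrite !unfold_in ?mul0r // => /eqP u0 /eqP v0.
by rewrite mulrDl -mulrA u0 v0 mulr0 addr0.
Qed.

HB.instance Definition _ a :=
  GRing.isSubmodClosed.Build R R^o (ann a) (ann_closed a).

End Ideals.

Arguments two_semiregular R : clear implicits.
Arguments semiregular R : clear implicits.
Arguments is_field R : clear implicits.
Arguments valuation_ring R : clear implicits.
Arguments bezout_ring R : clear implicits.

(* Main.v *)
From mathcomp Require Import all_boot all_algebra perm.
From mathcomp.multinomials Require Import freeg.
From mathcomp.classical Require Import boolp classical_sets functions.
From HB Require Import structures.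
Require Import Defs.
Import GRing.Theory.
Local Open Scope ring_scope.

Set Implicit Arguments.
Unset Strict Implicit.
Unset Printing Implicit Defensive.

(** The hub is the annihilator condition, that R is a valuation ring in which
    some nonzero element has a nonzero finitely generated annihilator: each of
    the other conditions is compared with it.

    From cyclic modules to valuation rings.  Let a_1, ..., a_n be minimal
    generators of a proper nonzero ideal I of the local ring R, and suppose
    that R/I is 2-periodic.  Splitting trivial summands off the periodic
    sequence leaves 0 -> R/I -> R^n -> I -> 0, so the relations between the a_i
    are the multiples of one vector x with annihilator I ([minimal_relations]).
    For n = 2 this is absurd: x_1 is in I's annihilator, so (x_1, 0) is a
    relation and equals c x; if c is in the maximal ideal then x_1 = 0, if c is
    a unit then x_2 = 0, and either way the relation (a_2, -a_1) shows that one
    of the generators vanishes.  Hence principal ideals are comparable.  For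
    n = 1 the vector x generates the annihilator of a_1.

    From one annihilator to all.  In a local valuation ring, one nonzero
    element with a nonzero principal annihilator forces every annihilator
    (0 : c) to be a principal ideal (b) with (0 : b) = (c)
    ([double_annihilator]).  Column operations over a valuation ring diagonalize
    the row space of a matrix A, and replacing each diagonal entry by the
    generator of its annihilator yields square matrices D and W, each having as
    left kernel the row space of the other, where D has the row space of A
    ([periodic_presentation]).  This makes every finitely presented module
    2-periodic, and embeds it in R^n.

    Flatness.  Over a valuation ring a module F is flat exactly when a z = 0
    implies z = b z' with b a = 0 ([flat_torsion_divisible],
    [flat_of_torsion_divisible]).  With this criterion, the maximal
    ideal of a valuation ring is flat exactly when the annihilator condition
    fails; and in a flat module containing R/(a) it produces an element of R
    whose annihilator is (a).

    Semiregularity.  A module M is recovered from the functions h : M -> R that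
    respect finitely many of its linear relations, because a finitely presented
    module embeds in R^n ([finite_separation]).  So M embeds in the module of
    functions of h, modulo those that vanish on all h respecting some finite set
    of relations; on this reduced power of R the criterion for flatness can be
    checked pointwise ([valuation_semiregular]). *)

(** * Submodules, local rings and valuation rings *)

(** Submodules are boolean predicates with a canonical structure; this builds
    one from any linearly closed property. *)
Lemma submod_exists (R : comNzRingType) (V : lmodType R) (A : V -> Prop) :
    A 0 -> (forall c u v, A u -> A v -> A (c *: u + v)) ->
  exists S : submodClosed V, forall v, v \in S <-> A v.
Proof.
move=> A0 Alin; pose p : {pred V} := fun v => `[< A v >].
have pP : submod_closed p.
  split=> [|c u v /asboolP Au /asboolP Av]; apply/asboolP => //.
  exact: Alin.
pose mix := GRing.isSubmodClosed.Build R V p pP.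
pose S : submodClosed V := HB.pack p mix.
by exists S => v; split=> /asboolP.
Qed.

Lemma submod_lin (R : comNzRingType) (V : lmodType R) (S : submodClosed V) c u v :
  u \in S -> v \in S -> c *: u + v \in S.
Proof. by move=> uS vS; apply: rpredD => //; apply: rpredZ. Qed.

Section Ideals.
Variable R : comNzRingType.
Implicit Types a b c x y : R.

Lemma idealM (I : submodClosed R^o) c x : x \in I -> c * x \in I.
Proof. by move=> xI; have := @rpredZ R R^o I c x xI. Qed.

Lemma ideal0 (I : submodClosed R^o) : (0 : R) \in I.
Proof. by have := @rpred0 R^o I. Qed.

Lemma idealD (I : submodClosed R^o) (x y : R) : x \in I -> y \in I -> x + y \in I.
Proof. by move=> xI yI; have := submod_lin 1 xI yI; rewrite scale1r. Qed.

Lemma idealN (I : submodClosed R^o) (x : R) : x \in I -> - x \in I.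
Proof. by rewrite -mulN1r; apply: idealM. Qed.

Definition divides a b : Prop := exists c, b = c * a.

Lemma principal_submod a :
  exists I : submodClosed R^o, forall x, x \in I <-> divides a x.
Proof.
apply: submod_exists => [|c u v [r ->] [s ->]]; first by exists 0; rewrite mul0r.
by exists (c * r + s); rewrite mulrDl -mulrA.
Qed.

Lemma valuation_ringP :
  valuation_ring R <-> forall a b, divides a b \/ divides b a.
Proof.
split=> [val a b | val I J].
  have [I inI] := principal_submod a; have [J inJ] := principal_submod b.
  have aI : a \in I by apply/inI; exists 1; rewrite mul1r.
  have bJ : b \in J by apply/inJ; exists 1; rewrite mul1r.
  by case: (val I J) => [/(_ a aI)/inJ|/(_ b bJ)/inI]; [right | left].
have [IJ|nIJ] := pselect {subset I <= J}; [by left | right => y yJ].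
have [x xI xJ] : exists2 x, x \in I & x \notin J.
  apply: contrapT => nex; apply: nIJ => x xI; apply: contrapT => /negP xJ.
  by apply: nex; exists x.
case: (val x y) => -[c def]; first by rewrite def idealM.
by case/negP: xJ; rewrite def idealM.
Qed.

(** Finitely many elements of a valuation ring include a common divisor of all:
    this is what makes row and column clearing possible. *)
Lemma divisor_of_all (T : eqType) (f : T -> R) (s : seq T) :
    (forall a b, divides a b \/ divides b a) -> s <> [::] ->
  exists2 i, i \in s & forall j, j \in s -> divides (f i) (f j).
Proof.
move=> val; elim: s => // i [|k s] IHs _.
  exists i; rewrite ?mem_head // => j; rewrite inE => /eqP ->.
  by exists 1; rewrite mul1r.
have [//|l ls lP] := IHs; case: (val (f i) (f l)) => -[c def].
  exists i; rewrite ?mem_head // => j; rewrite inE => /orP[/eqP->|/lP[d ->]].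
    by exists 1; rewrite mul1r.
  by exists (d * c); rewrite def mulrA.
exists l; first by rewrite in_cons ls orbT.
move=> j; rewrite inE => /orP[/eqP->|/lP //].
by exists c.
Qed.

Section Local.
Variable P : submodClosed R^o.
Hypothesis P_local : unique_maximal_ideal P.

(** A nonunit x lies in some maximal ideal, obtained by Zorn's lemma among the
    proper ideals containing x, and the only maximal ideal is P. *)
Lemma local_unit x : x \notin P -> exists y, y * x = 1.
Proof.
move=> xP; apply: contrapT => x_nunit.
pose T := {J : submodClosed R^o | 1 \notin J /\ x \in J}.
pose le (J K : T) := `[< {subset sval J <= sval K} >].
have [I inI] := principal_submod x.
have T0 : T.
  exists I; split; last by apply/inI; exists 1; rewrite mul1r.
  by apply/negP => /inI[y y1]; apply: x_nunit; exists y.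
have [||A Atot|J Jmax] := @ZL_preorder T T0 le.
- by move=> J; apply/asboolP.
- move=> J K L /asboolP KJ /asboolP JL; apply/asboolP => z /KJ; exact: JL.
- have [A0|/set0P[J0 AJ0]] := eqVneq A set0.
    by exists T0 => J; rewrite A0.
  have [||U inU] := @submod_exists R R^o (fun v => exists2 K, A K & v \in sval K).
  + by exists J0; rewrite ?rpred0.
  + move=> c u v [J AJ uJ] [K AK vK].
    have [/asboolP JK|/asboolP KJ] := Atot J K AJ AK.
      by exists K => //; apply: submod_lin; [exact: JK | exact: vK].
    by exists J => //; apply: submod_lin; [exact: uJ | exact: KJ].
  have UT : 1 \notin U /\ x \in U.
    split; first by apply/negP => /inU[K _]; apply/negP; case: (svalP K).
    by apply/inU; exists J0; last by case: (svalP J0).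
  exists (exist _ U UT) => K AK; apply/asboolP => v vK /=.
  by apply/inU; exists K.
have [J1 xJ] := svalP J.
have Jmaximal : maximal_ideal (sval J).
  split=> // K JK K1 v; apply/idP/idP => [|/JK //].
  have KT : 1 \notin K /\ x \in K by rewrite K1 JK.
  have /asboolP := Jmax (exist _ K KT) (asboolT JK); exact.
by rewrite (P_local.2 _ Jmaximal) in xJ; rewrite xJ in xP.
Qed.

Lemma nonfield_local : ~ is_field R -> exists2 a : R, a != 0 & a \in P.
Proof.
move=> nfield; apply: contrapT => none; apply: nfield => x x0.
by apply: local_unit; apply/negP => xP; apply: none; exists x.
Qed.

Lemma local_not1 : 1 \notin P.
Proof. by case: P_local => -[]. Qed.

(** Nakayama's lemma for a principal ideal: 1 - p is a unit. *)
Lemma local_cancel p x : p \in P -> x = p * x -> x = 0.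
Proof.
move=> pP /eqP; rewrite -subr_eq0 -[X in X - _]mul1r -mulrBl => /eqP px0.
have [|y yp] := @local_unit (1 - p).
  by apply: contra local_not1 => /rpredD/(_ pP); rewrite subrK.
by rewrite -[x]mul1r -yp -mulrA px0 mulr0.
Qed.

End Local.
End Ideals.

(** * Linear maps and projective modules *)

Section Linear.
Variable R : comNzRingType.
Implicit Types V W M : lmodType R.

Lemma linear_exists V W (f : V -> W) :
  linear f -> exists g : {linear V -> W}, g =1 f.
Proof.
move=> flin; pose mix := GRing.isLinear.Build R V W _ f flin.
by pose g : {linear V -> W} := HB.pack f mix; exists g.
Qed.

Lemma factor_through_surj V W M (p : {linear V -> M}) (f : {linear V -> W}) :
    surj p -> (forall v, p v = 0 -> f v = 0) ->
  exists g : {linear M -> W}, forall v, g (p v) = f v.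
Proof.
move=> /choice[s ps] ker_pf.
have fE u v : p u = p v -> f u = f v.
  move=> puv; apply/eqP; rewrite -subr_eq0 -linearB; apply/eqP/ker_pf.
  by rewrite linearB puv subrr.
have [|g gE] := @linear_exists M W (f \o s).
  by move=> c x y; rewrite /= -linearP; apply: fE; rewrite linearP !ps.
by exists g => v; rewrite gE; apply/fE/ps.
Qed.

Lemma ker_submod V W (f : {linear V -> W}) :
  exists S : submodClosed V, forall v, v \in S <-> f v = 0.
Proof.
apply: submod_exists => [|c u v fu fv]; first exact: raddf0.
by rewrite linearP fu fv scaler0 addr0.
Qed.

Lemma quot_pi_eq0 V (S : submodClosed V) v : quot_pi S v = 0 <-> v \in S.
Proof.
have -> : 0 = quot_pi S 0 by rewrite linear0.
by rewrite (quot_piP S v 0) subr0.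
Qed.

Lemma quot_pi_surj V (S : submodClosed V) : surj (quot_pi S).
Proof.
move=> x; exists (repr (x : Quotient.quot (submod_pred S))).
exact: quot_piK.
Qed.

(** The quotient of A by ker g receives f through a choice of preimages under g,
    so the lifting property applies to it although g need not be onto. *)
Lemma projective_lift (Q A C : lmodType R)
    (g : {linear A -> C}) (f : {linear Q -> C}) :
    projective Q -> (forall x, exists y, g y = f x) ->
  exists h : {linear Q -> A}, forall x, g (h x) = f x.
Proof.
move=> Qproj /choice[s gs]; have [K inK] := ker_submod g.
have [|f' f'E] := @linear_exists Q (quot_mod K) (quot_pi K \o s).
  move=> c x y; rewrite /= -linearP; apply/quot_piP/inK.
  by rewrite linearB /= linearP !gs linearP subrr.
have [h hE] := Qproj A (quot_mod K) (quot_pi K) f' (quot_pi_surj (S := K)).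
exists h => x; have := hE x; rewrite f'E => /quot_piP/inK.
by rewrite linearB gs /= => /eqP; rewrite subr_eq0 => /eqP.
Qed.

Lemma row_mod_projective n : projective 'rV[R]_n.
Proof.
move=> A B g f /(_ (f (delta_mx 0 _)))-/choice[a ga].
have [|h hE] := @linear_exists 'rV[R]_n A (fun x => \sum_j x 0 j *: a j).
  move=> c x y; rewrite scaler_sumr -big_split; apply: eq_bigr => j _ /=.
  by rewrite !mxE scalerDl scalerA.
exists h => x; rewrite hE [x in RHS]row_sum_delta !linear_sum.
by apply: eq_bigr => j _; rewrite !linearZ /= ga.
Qed.

Lemma fglift_linear (K : choiceType) V (f : K -> V) : linear (fglift f).
Proof.
have fB : {morph fglift f : u v / u - v} by apply: lift_is_additive.
have f0 : fglift f 0 = 0 by rewrite -[0 in LHS](subrr 0) fB subrr.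
have fD : {morph fglift f : u v / u + v}.
  by move=> u v; rewrite -{1}[v]opprK -[- v]add0r !fB f0 sub0r opprK.
move=> c u v; rewrite fD; congr (_ + _).
rewrite -[u in RHS]freeg_sumE [c *: u]/(fgscale c u) /fgscale.
rewrite !(big_morph _ fD f0) scaler_sumr.
by apply: eq_bigr => z _; rewrite !liftU scalerA.
Qed.

(** A projective module is a direct summand of a free one, whose coordinate
    functions separate points. *)
Lemma projective_separated (Q : lmodType R) (x : Q) :
  projective Q -> x != 0 -> exists phi : {linear Q -> R^o}, phi x != 0.
Proof.
move=> Qproj x0; pose F : lmodType R := {freeg Q / R}.
have [g gE] := @linear_exists F Q _ (fglift_linear (fun y : Q => y)).
have [|h hE] := @projective_lift Q F Q g idfun Qproj.
  by move=> y; exists << y >>; rewrite gE liftU scale1r.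
have [y hy] : exists y, coeff y (h x) != 0.
  apply: contrapT => hx0; move: x0; rewrite -[x]hE.
  suff -> : h x = 0 by rewrite linear0 eqxx.
  apply/eqP/freeg_eqP => y; rewrite coeff0; apply/eqP.
  by apply: contra_notT hx0 => hy; exists y.
have [|phi phiE] := @linear_exists Q R^o (fun z => coeff y (h z)).
  by move=> c u v; rewrite linearP coeffD coeffZ.
by exists phi; rewrite phiE.
Qed.

End Linear.

(** * Relations between minimal generators *)

Section Relations.
Variables (R : comNzRingType) (P : submodClosed R^o).
Hypothesis P_local : unique_maximal_ideal P.

Lemma local_prime (x y : R) : x \notin P -> y \notin P -> x * y \notin P.
Proof.
move=> /(local_unit P_local)[z zx]; apply: contra => /(idealM z).
by rewrite mulrA zx mul1r.
Qed.

Lemma local_1mod (x : R) : x - 1 \in P -> x \notin P.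
Proof.
move=> x1; apply: contra (local_not1 P_local) => /idealN/(idealD x1)/idealN.
by rewrite addrAC subrr add0r opprK.
Qed.

(** In the Leibniz formula the term of the identity permutation is a unit and
    every other term has an off-diagonal factor, in P. *)
Lemma invertible_mod_local n (A : 'M[R]_n) :
    (forall i j, A i j - (i == j)%:R \in P) ->
  exists B, B *m A = 1%:M.
Proof.
move=> A1; suff /(local_unit P_local)[y ydet] : \det A \notin P.
  exists (y *: \adj A); rewrite -scalemxAl mul_adj_mx.
  by rewrite -mul_scalar_mx -scalar_mxM ydet.
have diag : \prod_i A i i \notin P.
  apply: (big_ind (fun x : R => x \notin P)) => [|x y|i _];
    [exact: local_not1 | exact: local_prime |].
  by apply: local_1mod; have := A1 i i; rewrite eqxx.
rewrite /determinant (bigD1 (1%g : 'S_n)) //= odd_perm1 expr0 mul1r.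
under eq_bigr do rewrite perm1.
apply: contra diag => detP; rewrite -[X in X \in P](addrK (\sum_(s : 'S_n | s != 1%g)
   (-1) ^+ s * \prod_i A i (s i))).
apply: (idealD detP); apply: idealN.
apply: (big_ind (fun x : R => x \in P)) => [|x y|s s1];
  [exact: ideal0 | exact: idealD |].
have [i si] : exists i, s i != i.
  apply: contrapT => sid; case/eqP: s1; apply/permP => i; rewrite perm1.
  by apply/eqP; apply: contra_notT sid => ?; exists i.
apply: idealM; rewrite (bigD1 i) //= mulrC; apply: idealM.
by have := A1 i (s i); rewrite eq_sym (negPf si) subr0.
Qed.

Lemma row_submod m n (A : 'M[R]_(m, n)) :
  exists S : submodClosed 'rV[R]_n, forall x, x \in S <-> exists y, x = y *m A.
Proof.
apply: submod_exists => [|c u v [y ->] [z ->]]; first by exists 0; rewrite mul0mx.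
by exists (c *: y + z); rewrite mulmxDl scalemxAl.
Qed.

Lemma coker_finitely_presented m n (A : 'M[R]_(m, n)) (S : submodClosed 'rV[R]_n) :
    (forall x, x \in S <-> exists y, x = y *m A) ->
  finitely_presented (quot_mod S).
Proof.
move=> inS; exists m, n, (mulmxr A), (quot_pi S); split; last exact: quot_pi_surj.
move=> y; rewrite quot_pi_eq0 inS.
by split=> -[x]; exists x.
Qed.

Lemma coker_cyclic m (a : 'cV[R]_m) (S : submodClosed 'rV[R]_1) :
    (forall x, x \in S <-> exists y, x = y *m a) -> cyclic_mod (quot_mod S).
Proof.
move=> inS; exists (quot_pi S 1%:M) => y; have [x <-] := quot_pi_surj y.
exists (x 0 0); rewrite -linearZ; congr (quot_pi S _).
by apply/matrixP => i j; rewrite !ord1 !mxE mulr1.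
Qed.

(** The sequence 0 -> R/I -> R^n -> I -> 0 hidden in a 2-periodic resolution of
    R/I, for an ideal I with generators a_i, minimal in the sense that all their
    relations have coefficients in P.  Write the resolution as
    P2 -> P1 -> R/I and let m generate the image of R/I in P2.  As P2 is
    projective and d sends it into the preimage of I, there is psi : P2 -> R^n
    above I; elements u_i lifting the a_i give U : R^n -> P2, and minimality
    makes psi U invertible.  Normalized so that psi U = 1, the difference
    m - U (psi m) is killed by d, hence equals c m.  If c were a unit, psi m = 0
    and the a_i would satisfy no relation, although a projective module
    containing R/I forces I to have a nonzero annihilator.  So 1 - c is a unit,
    m lies in the image of U, and x = psi m generates the relations. *)
Lemma minimal_relations n (a : 'cV[R]_n.+1) (S : submodClosed 'rV[R]_1) :
    (forall i, a i 0 \in P) ->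
    (forall r : 'rV_n.+1, r *m a = 0 -> forall i, r 0 i \in P) ->
    (forall x, x \in S <-> exists y, x = y *m a) ->
    two_periodic (quot_mod S) ->
  exists x : 'rV_n.+1,
    (forall r : 'rV_n.+1, r *m a = 0 <-> exists c, r = c *: x) /\
    (forall c, c *: x = 0 <-> exists r : 'rV_n.+1, c%:M = r *m a).
Proof.
move=> aP amin inS [P1 [P2 [i [d [p [[P1proj P2proj] [i_inj exd exp p_surj]]]]]]].
pose m0 := quot_pi S 1%:M.
have pi_scalar c : quot_pi S c%:M = c *: m0.
  by rewrite -linearZ /= scalemx1.
have m0_eq0 c : c *: m0 = 0 <-> exists r : 'rV_n.+1, c%:M = r *m a.
  by rewrite -pi_scalar quot_pi_eq0 inS.
have relP (r : 'rV_n.+1) : (r *m a) 0 0 \in P.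
  rewrite mxE; apply: (big_ind (fun x : R => x \in P)) => [|x y|j _];
    [exact: ideal0 | exact: idealD |].
  exact: idealM.
have m0_neq0 : m0 != 0.
  apply/eqP => m00; have [|r ra] := (m0_eq0 1).1; first by rewrite scale1r.
  by have := relP r; rewrite -ra mxE eqxx; apply/negP/local_not1.
have [phi0 phi0E] := @projective_lift R P1 _ _ (quot_pi S) p P1proj
  (fun x => quot_pi_surj (p x)).
have [e0 pe0] := p_surj m0.
(* phi0 lifts p to R; dividing e0 by the unit w yields e above m0 with
   phi e = 1, so that phi splits off the summand R e of P1. *)
pose w := phi0 e0 0 0.
have w_m0 : w *: m0 = m0.
  rewrite -[in RHS]pe0 -phi0E -pi_scalar; congr (quot_pi S _).
  by apply: esym; exact: mx11_scalar.
have [v vw] : exists v, v * w = 1.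
  apply: (local_unit P_local); apply: local_1mod.
  have /m0_eq0[r rw] : (w - 1) *: m0 = 0 by rewrite scalerBl w_m0 scale1r subrr.
  by have := relP r; rewrite -rw mxE eqxx.
have [phi phiE] : exists phi : {linear P1 -> R^o}, forall z, phi z = phi0 z 0 0.
  have [|phi phiE] := @linear_exists R P1 R^o (fun z => phi0 z 0 0).
    by move=> c x y; rewrite linearP !mxE.
  by exists phi.
have p_phi z : p z = (phi z : R) *: m0.
  by rewrite -phi0E -pi_scalar phiE; congr (quot_pi S _); exact: mx11_scalar.
pose e := v *: e0.
have phi_e : phi e = 1 by rewrite linearZ /= phiE -/w.
have pe : p e = m0 by rewrite p_phi phi_e scale1r.
pose theta z : R := phi (d z).
have thetaP (z : P2) : exists r : 'rV_n.+1, r *m a = (theta z)%:M.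
  have pdz : p (d z) = 0 by apply/exp; exists z.
  by have /m0_eq0[r ra] : theta z *: m0 = 0; [rewrite -p_phi | exists r].
have [psi psiE] : exists psi : {linear P2 -> 'rV[R]_n.+1},
    forall z, psi z *m a = (theta z)%:M.
  have [|t tE] := @linear_exists R P2 'M[R]_1 (fun z => (theta z)%:M).
    by move=> c x y; rewrite /theta !linearP /= scale_scalar_mx -raddfD.
  have [|psi psiE] := @projective_lift R P2 _ _ (mulmxr a) t P2proj.
    by move=> z; have [r ra] := thetaP z; exists r; rewrite tE.
  by exists psi => z; rewrite -tE -psiE.
have /choice[u du] (k : 'I_n.+1) : exists z, d z = a k 0 *: e.
  apply/exp; rewrite linearZ /= pe; apply/m0_eq0; exists (delta_mx 0 k).
  by rewrite -rowE [RHS]mx11_scalar mxE.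
(* The rows of A - 1 are relations between the a_i, so A = 1 modulo P. *)
pose A := \matrix_k psi (u k).
have Aa : A *m a = a.
  apply/row_matrixP => k; rewrite row_mul rowK psiE.
  have -> : theta (u k) = a k 0 by rewrite /theta du linearZ /= phi_e; apply: mulr1.
  by rewrite [RHS]mx11_scalar mxE.
have [B BA] : exists B, B *m A = 1%:M.
  apply: invertible_mod_local => k l.
  have := amin (row k (A - 1%:M)) _ l; rewrite !mxE; apply.
  by rewrite -row_mul mulmxBl Aa mul1mx subrr row0.
have Ba : B *m a = a by rewrite -[in LHS]Aa mulmxA BA mul1mx.
have [|U UE] := @linear_exists R 'rV[R]_n.+1 P2 (fun r => \sum_k (r *m B) 0 k *: u k).
  move=> c x y; rewrite scaler_sumr -big_split; apply: eq_bigr => k _ /=.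
  by rewrite mulmxDl -scalemxAl !mxE scalerDl scalerA.
have psiU r : psi (U r) = r.
  rewrite UE linear_sum -[RHS]mulmx1 -BA mulmxA [RHS]mulmx_sum_row.
  by apply: eq_bigr => k _; rewrite linearZ /= rowK.
have dU r : d (U r) = (r *m a) 0 0 *: e.
  rewrite UE linear_sum -Ba mulmxA mxE scaler_suml.
  by apply: eq_bigr => k _; rewrite linearZ /= du scalerA.
pose m := i m0.
have dm : d m = 0 by apply/exd; exists m0.
have ker_d z : d z = 0 -> exists c, z = c *: m.
  move=> /exd[y <-]; have [x <-] := quot_pi_surj y.
  by exists (x 0 0); rewrite -linearZ /= -pi_scalar -mx11_scalar.
have m_eq0 c : c *: m = 0 <-> exists r : 'rV_n.+1, c%:M = r *m a.
  rewrite -m0_eq0 -linearZ -[in X in X <-> _](linear0 i).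
  by split=> [/i_inj | /= ->].
have psi_m_a : psi m *m a = 0.
  by rewrite psiE /theta dm linear0 raddf0.
have [c mc] : exists c, m - U (psi m) = c *: m.
  by apply: ker_d; rewrite linearB dm dU psi_m_a mxE scale0r subrr.
have psi_mc : c *: psi m = 0 by rewrite -linearZ /= -mc linearB psiU subrr.
have c_P : c \in P.
  apply/negPn/negP => /(local_unit P_local)[c' c'c].
  have psi_m0 : psi m = 0 by rewrite -[psi m]scale1r -c'c -scalerA psi_mc scaler0.
  have rel0 (r : 'rV_n.+1) : r *m a = 0 -> r = 0.
    move=> ra; have [|k Urk] := ker_d (U r); first by rewrite dU ra mxE scale0r.
    by rewrite -[r]psiU Urk linearZ /= psi_m0 scaler0.
  have m_neq0 : m != 0.
    by apply: contra_neq m0_neq0 => m_0; apply: i_inj; rewrite linear0.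
  (* A functional with chi m != 0 sends I m = 0 to 0, so chi m kills I and
     chi m times a unit vector is a nonzero relation. *)
  have [chi chi_m] := projective_separated P2proj m_neq0.
  have chi_a : (chi m : R) *: (delta_mx 0 0 : 'rV_n.+1) *m a = 0.
    rewrite -scalemxAl -rowE [X in _ *: X]mx11_scalar mxE scale_scalar_mx mulrC.
    have /(congr1 chi) : a 0 0 *: m = 0.
      by apply/m_eq0; exists (delta_mx 0 0); rewrite -rowE [RHS]mx11_scalar mxE.
    rewrite linearZ linear0 => chi_am.
    by have -> : a 0 0 * chi m = 0 := chi_am; rewrite raddf0.
  case/eqP: chi_m; have /matrixP/(_ 0 0) := rel0 _ chi_a.
  by rewrite !mxE mulr1.
have m_U : (1 - c) *: m = U (psi m).
  by rewrite scalerBl scale1r -mc opprB addrC subrK.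
exists (psi m); split=> [r | k]; first split=> [ra | [k ->]].
- have [|k Urk] := ker_d (U r); first by rewrite dU ra mxE scale0r.
  by exists k; rewrite -linearZ /= -Urk psiU.
- by rewrite -scalemxAl psi_m_a scaler0.
rewrite -m_eq0; split=> [km | km]; last by rewrite -linearZ /= km linear0.
have [|c' c'c] := local_unit P_local (x := 1 - c).
  by apply: local_1mod; rewrite addrAC subrr add0r idealN.
have -> : k *: m = c' *: U (k *: psi m).
  by rewrite linearZ /= -m_U !scalerA mulrAC c'c mul1r.
by rewrite km linear0 scaler0.
Qed.

End Relations.

Section CyclicPeriodic.
Variables (R : comNzRingType) (P : submodClosed R^o).
Hypothesis P_local : unique_maximal_ideal P.
Hypothesis periodic : forall M : lmodType R,
  finitely_presented M -> cyclic_mod M -> two_periodic M.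

Lemma cyclic_relations n (a : 'cV[R]_n.+1) :
    (forall i, a i 0 \in P) ->
    (forall r : 'rV_n.+1, r *m a = 0 -> forall i, r 0 i \in P) ->
  exists x : 'rV_n.+1,
    (forall r : 'rV_n.+1, r *m a = 0 <-> exists c, r = c *: x) /\
    (forall c, c *: x = 0 <-> exists r : 'rV_n.+1, c%:M = r *m a).
Proof.
move=> aP amin; have [S inS] := row_submod a.
apply: (minimal_relations P_local aP amin inS).
by apply: periodic; [apply: coker_finitely_presented inS | apply: coker_cyclic inS].
Qed.

(** Two elements dividing neither way are minimal generators; the single vector
    x generating their relations also generates (x_1, 0), because x_1 kills both
    of them, and this leaves no room for the relation (b, -a). *)
Lemma periodic_valuation (a b : R) : divides a b \/ divides b a.
Proof.
apply: contrapT => /not_orP[nab nba].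
pose g : 'cV[R]_2 := \col_i (if i == 0 then a else b).
have relE (r : 'rV_2) : r *m g = (r 0 0 * a + r 0 1 * b)%:M.
  apply/matrixP => i j; rewrite !ord1 !mxE big_ord_recl big_ord1 !mxE /=.
  by congr (_ + r 0 _ * _); apply/val_inj.
have divPl x y t z : x \notin P -> x * y + t * z = 0 -> divides z y.
  move=> /(local_unit P_local)[x' x'x] xyz; exists (- (x' * t)).
  by rewrite mulNr -mulrA -mulrN -(addr0_eq xyz) opprK mulrA x'x mul1r.
have nunit x y : ~ divides x y -> x \in P.
  move=> nxy; apply/negPn/negP => /(local_unit P_local)[x' x'x]; apply: nxy.
  by exists (y * x'); rewrite -mulrA x'x mulr1.
have aP := nunit _ _ nab; have bP := nunit _ _ nba.
have gE0 i : g i 0 = if i == 0 then a else b by rewrite mxE.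
have [||x [relx annx]] := @cyclic_relations 1 g.
- by move=> i; rewrite gE0; case: ifP.
- move=> r; rewrite relE => /matrixP/(_ 0 0); rewrite !mxE eqxx mulr1n => rab i.
  apply/negPn/negP => ri; have [i0|i1] := eqVneq i 0.
    by apply: nba; apply: divPl rab; rewrite i0 in ri.
  apply: nab; apply: (divPl (r 0 1) b (r 0 0) a); last by rewrite addrC.
  have i1' : i = 1 by case: i i1 {ri} => -[|[|//]] // ? _; apply/val_inj.
  by rewrite i1' in ri.
have [k kx] : exists k, k *: x = \row_i (if i == 0 then b else - a).
  suff /relx[k ->] : (\row_i (if i == 0 then b else - a)) *m g = 0 by exists k.
  by rewrite relE !mxE /= mulNr mulrC subrr raddf0.
have x0a : x 0 0 * a = 0.
  have /matrixP/(_ 0 0) : a *: x = 0.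
    by apply/annx; exists (delta_mx 0 0); rewrite relE !mxE /= mul1r mul0r addr0.
  by rewrite !mxE mulrC.
have [c cx] : exists c, c *: x = \row_i (if i == 0 then x 0 0 else 0).
  suff /relx[c ->] : (\row_i (if i == 0 then x 0 0 else 0)) *m g = 0 by exists c.
  by rewrite relE !mxE /= mul0r addr0 x0a raddf0.
have kx0 : k * x 0 0 = b by have /matrixP/(_ 0 0) := kx; rewrite !mxE.
have kx1 : k * x 0 1 = - a by have /matrixP/(_ 0 1) := kx; rewrite !mxE.
have cx0 : c * x 0 0 = x 0 0 by have /matrixP/(_ 0 0) := cx; rewrite !mxE.
have cx1 : c * x 0 1 = 0 by have /matrixP/(_ 0 1) := cx; rewrite !mxE.
have [cP|/(local_unit P_local)[c' c'c]] := boolP (c \in P).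
  by apply: nab; exists 0; rewrite mul0r -kx0 (local_cancel P_local cP (esym cx0)) mulr0.
apply: nba; exists 0; rewrite mul0r -[a]opprK -kx1 -[x 0 1]mul1r -c'c.
by rewrite -mulrA cx1 !mulr0 oppr0.
Qed.

(** The case of one generator: the relations of a are its annihilator. *)
Lemma periodic_annihilator : ~ is_field R ->
  exists2 a : R, a != 0 &
    (exists2 r : R, r \in ann a & r != 0) /\ fg_ideal (ann a).
Proof.
move=> /(nonfield_local P_local)[a a0 aP].
have relE (r : 'rV_1) : r *m (a%:M : 'M_1) = (r 0 0 * a)%:M.
  by rewrite [r in LHS]mx11_scalar -scalar_mxM.
have [||x [relx annx]] := @cyclic_relations 0 a%:M.
- by move=> i; rewrite ord1 mxE eqxx.
- move=> r; rewrite relE => /matrixP/(_ 0 0); rewrite !mxE eqxx mulr1n => ra i.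
  apply/negPn/negP => /(local_unit P_local)[y]; rewrite ord1 => y1; case/eqP: a0.
  by rewrite -[a]mul1r -y1 -mulrA ra mulr0.
have annE r : r \in ann a <-> exists c, r = c * x 0 0.
  split=> [/eqP ra|[c ->]].
    have [|c rc] := (relx r%:M).1; first by rewrite relE mxE eqxx ra raddf0.
    by exists c; have /matrixP/(_ 0 0) := rc; rewrite !mxE eqxx.
  have /matrixP/(_ 0 0) : (c *: x) *m (a%:M : 'M_1) = 0 by apply/relx; exists c.
  by rewrite relE !mxE eqxx mulr1n => /eqP.
exists a => //; split.
  exists (x 0 0); first by apply/annE; exists 1; rewrite mul1r.
  apply/eqP => x0; have [|r r1] := (annx 1).1.
    by rewrite scale1r [x]mx11_scalar x0 raddf0.
  have /matrixP/(_ 0 0) := r1; rewrite relE !mxE eqxx !mulr1n => r1'.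
  by have := local_not1 P_local; rewrite r1' idealM.
exists [:: x 0 0] => r; rewrite annE; split=> [[c ->]|[c ->]].
  by exists (fun=> c); rewrite big_ord1.
by exists (c 0); rewrite big_ord1.
Qed.

End CyclicPeriodic.

(** * Annihilators in a valuation ring *)

Section Annihilators.
Variables (R : comNzRingType) (P : submodClosed R^o).
Hypothesis P_local : unique_maximal_ideal P.
Hypothesis val : forall a b : R, divides a b \/ divides b a.
Implicit Types a b c x y : R.

Lemma valuation_bezout : bezout_ring R.
Proof.
move=> I [s sI].
have mem_s (i : 'I_(size s)) : s`_i \in I.
  apply/sI; exists (fun j => (j == i)%:R); rewrite (bigD1 i) //= eqxx mul1r.
  by rewrite big1 ?addr0 // => j /negPf->; rewrite mul0r.
have [s0|sn0] := eqVneq (enum 'I_(size s)) [::].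
  exists 0 => x; rewrite sI; split=> -[c ->].
    exists 0; rewrite mul0r; apply: big1 => i _.
    by have := mem_enum 'I_(size s) i; rewrite s0.
  by exists (fun=> 0); rewrite mulr0 big1 // => i _; rewrite mul0r.
have [|i _ iP] := divisor_of_all (fun i : 'I_(size s) => s`_i) val
    (s := enum 'I_(size s)).
  exact/eqP.
exists s`_i => x; split=> [/sI[c ->]|[c ->]]; last exact: idealM.
have [I' inI'] := principal_submod s`_i; apply/inI'.
apply: (big_ind (fun y : R => y \in I')) => [|y z|j _].
- exact: ideal0.
- exact: idealD.
- by apply/idealM/inI'/iP; rewrite mem_enum.
Qed.

Definition generates_ann c b : Prop := forall x, x * c = 0 <-> divides b x.

(** If x kills b but is a proper divisor of c, say c = x t with t in P, then
    either b divides t, and c would vanish, or b = s t where s kills c, so that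
    b divides s and b is in P b. *)
Lemma generates_ann_sym c b :
  c != 0 -> b != 0 -> generates_ann c b -> generates_ann b c.
Proof.
move=> c0 b0 annc x; have bc : b * c = 0 by apply/annc; exists 1; rewrite mul1r.
split=> [xb|[y ->]]; last by rewrite -mulrA [c * b]mulrC bc mulr0.
have [//|[t ct]] := val c x.
have [tP|/(local_unit P_local)[t' t't]] := boolP (t \in P); last first.
  by exists t'; rewrite ct mulrA t't mul1r.
case/eqP: b0; have [[s bs]|[y ty]] := val t b; last first.
  by case/eqP: c0; rewrite ct ty -mulrA [b * x]mulrC xb mulr0.
have /annc[k sk] : s * c = 0 by rewrite ct mulrA -bs mulrC.
by apply: (local_cancel P_local (idealM k tP)); rewrite -mulrA [t * b]mulrC mulrA -sk.
Qed.

Section OneFinitelyGenerated.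
Variable a0 b0 : R.
Hypotheses (a0_neq0 : a0 != 0) (b0_neq0 : b0 != 0).
Hypothesis ann_a0 : generates_ann a0 b0.

Lemma b0a0 : b0 * a0 = 0.
Proof. by apply/ann_a0; exists 1; rewrite mul1r. Qed.

(** If a0 = t c then (0 : c) = (t b0); if c = t a0 then b0 = s t and
    (0 : c) = (s). *)
Lemma ann_principal c : c != 0 -> exists b, generates_ann c b.
Proof.
move=> c0; have [[t a0t]|[t ct]] := val c a0.
  exists (t * b0) => x; split=> [xc|[k ->]]; last first.
    by rewrite -mulrA mulrAC -a0t [a0 * b0]mulrC b0a0 mulr0.
  have [[y xy]|[y ty]] := val t x; last first.
    by case/eqP: a0_neq0; rewrite a0t ty -mulrA xc mulr0.
  have /ann_a0[k yk] : y * a0 = 0 by rewrite a0t mulrA -xy.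
  by exists k; rewrite xy yk -mulrA [b0 * t]mulrC.
have [[k tk]|[s b0s]] := val b0 t.
  by case/eqP: c0; rewrite ct tk -mulrA b0a0 mulr0.
exists s => x; split=> [xc|[k ->]]; last first.
  by rewrite ct -mulrA [s * _]mulrA -b0s b0a0 mulr0.
have /ann_a0[k xt] : x * t * a0 = 0 by rewrite -mulrA -ct.
have [//|[y sy]] := val s x.
have [kyP|/(local_unit P_local)[u uky]] := boolP (k * y \in P).
  have xt0 : x * t = 0.
    by apply: (local_cancel P_local kyP); rewrite {1}xt b0s sy !mulrA.
  by case/eqP: b0_neq0; rewrite b0s sy -mulrA xt0 mulr0.
by exists (u * k); rewrite sy mulrA -[u * k * y]mulrA uky mul1r.
Qed.

(** It remains that a nonzero c in P has a nonzero annihilator.  Otherwise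
    a0 = t c with t b0 = 0, and then t is a multiple of a0, which puts a0 in
    P a0. *)
Lemma double_annihilator c :
  exists b, generates_ann c b /\ generates_ann b c.
Proof.
have ann0 : generates_ann 0 1 /\ generates_ann 1 0.
  split=> x; rewrite ?mulr0 ?mulr1.
    by split=> // _; exists x; rewrite mulr1.
  by split=> [->|[k ->]]; [exists 0 |]; rewrite mulr0.
have [->|c0] := eqVneq c 0; first by exists 1.
have [cP|/(local_unit P_local)[c' c'c]] := boolP (c \in P); last first.
  exists 0; split=> x.
    split=> [xc|[k ->]]; last by rewrite mulr0 mul0r.
    by exists 0; rewrite -[x]mulr1 -c'c mulrCA xc !mulr0.
  rewrite mulr0; split=> // _; exists (x * c'); by rewrite -mulrA c'c mulr1.
have [b annc] := ann_principal c0.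
have b_neq0 : b != 0.
  apply/eqP => b_0; rewrite b_0 in annc.
  have c_reg x : x * c = 0 -> x = 0 by move=> /annc[k ->]; rewrite mulr0.
  have [[t a0t]|[t ct]] := val c a0; last first.
    by case/eqP: b0_neq0; apply: c_reg; rewrite ct mulrCA b0a0 mulr0.
  have /(generates_ann_sym a0_neq0 b0_neq0 ann_a0)[y ty] : t * b0 = 0.
    by apply: c_reg; rewrite mulrAC -a0t mulrC b0a0.
  case/eqP: a0_neq0; apply: (local_cancel P_local (idealM y cP)).
  by rewrite {1}a0t ty mulrAC.
by exists b; split=> //; apply: generates_ann_sym.
Qed.

End OneFinitelyGenerated.

Lemma fg_ann_double_annihilator a r :
    a != 0 -> r \in ann a -> r != 0 -> fg_ideal (ann a) ->
  forall c, exists b, generates_ann c b /\ generates_ann b c.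
Proof.
move=> a0 ra r0 /valuation_bezout[b inb].
have annb : generates_ann a b by move=> x; apply: iff_trans (inb x); split=> /eqP.
apply: (double_annihilator a0 _ annb); apply: contra_neq r0 => b0.
by have /inb[c ->] := ra; rewrite b0 mulr0.
Qed.

End Annihilators.

(** * Periodic presentations over a valuation ring *)

Section PeriodicPresentation.
Variable R : comNzRingType.

(** A row with an entry 1 is carried to the first unit row by a transposition
    of columns followed by clearing the other entries. *)
Lemma unimodular_row n (r : 'rV[R]_(1 + n)) j : r 0 j = 1 ->
  exists V V' : 'M[R]_(1 + n), [/\ V *m V' = 1%:M, V' *m V = 1%:M
                           & r *m V = row_mx 1%:M 0].
Proof.
move=> rj; pose T : 'M[R]_(1 + n) := tperm_mx j 0.
have TT : T *m T = 1%:M by rewrite -perm_mxM tperm2 perm_mx1.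
have rT0 : (r *m T) 0 0 = 1 by rewrite -xcolE mxE tpermR.
pose s := rsubmx (r *m T).
have rTE : r *m T = row_mx 1%:M s.
  rewrite -[LHS]hsubmxK; congr row_mx; rewrite [LHS]mx11_scalar mxE.
  by rewrite -[RHS]/(1%:M) -rT0; congr ((_ *m _) _ _)%:M; apply/val_inj.
pose C (t : 'rV[R]_n) : 'M[R]_(1 + n) := block_mx 1%:M t 0 1%:M.
have CC t u : t + u = 0 -> C t *m C u = 1%:M.
  move=> tu; rewrite mulmx_block !(mul1mx, mulmx1, mul0mx, mulmx0, addr0, add0r).
  by rewrite addrC tu -scalar_mx_block.
exists (T *m C (- s)), (C s *m T); split.
- by rewrite mulmxA -[T *m _ *m _]mulmxA CC ?addNr // mulmx1.
- by rewrite mulmxA -[C s *m T *m T]mulmxA TT mulmx1 CC ?subrr.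
rewrite mulmxA rTE mul_row_block !(mul1mx, mulmx1, mulmx0, addr0).
by rewrite addNr.
Qed.

Hypothesis val : forall a b : R, divides a b \/ divides b a.
Hypothesis dann : forall c : R, exists b, generates_ann c b /\ generates_ann b c.

(** Multiplication by D and W on row vectors forms an exact 2-periodic
    complex. *)
Definition periodic_pair n (D W : 'M[R]_n) : Prop :=
  (forall x : 'rV_n, x *m W = 0 <-> exists y, x = y *m D) /\
  (forall x : 'rV_n, x *m D = 0 <-> exists y, x = y *m W).

Lemma periodic_pair_block (g b : R) n (D W : 'M[R]_n) :
    generates_ann g b -> generates_ann b g -> periodic_pair D W ->
  periodic_pair (block_mx g%:M 0 0 D : 'M_(1 + n))
                (block_mx b%:M 0 0 W : 'M_(1 + n)).
Proof.
have half (g' b' : R) (D' W' : 'M[R]_n) : generates_ann b' g' ->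
    (forall x : 'rV_n, x *m W' = 0 <-> exists y, x = y *m D') ->
  forall x : 'rV_(1 + n), x *m (block_mx b'%:M 0 0 W' : 'M_(1 + n)) = 0 <->
    exists y, x = y *m (block_mx g'%:M 0 0 D' : 'M_(1 + n)).
  move=> annb kerW x; rewrite -[x]hsubmxK mul_row_block !mulmx0 addr0 add0r.
  split=> [|[y]].
    rewrite -[X in _ = X]row_mx0 => /eq_row_mx[x1 /kerW[y xy]].
    have /annb[z xz] : lsubmx x 0 0 * b' = 0.
      by have /matrixP/(_ 0 0) := x1; rewrite mul_mx_scalar !mxE mulrC.
    exists (row_mx z%:M y); rewrite mul_row_block !mulmx0 addr0 add0r -xy.
    by rewrite -scalar_mxM -xz -mx11_scalar.
  rewrite -[y]hsubmxK mul_row_block !mulmx0 addr0 add0r => /eq_row_mx[-> xy].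
  rewrite -[X in _ = X]row_mx0; congr row_mx; last by apply/kerW; exists (rsubmx y).
  rewrite -mulmxA -scalar_mxM; have -> : g' * b' = 0 by apply/annb; exists 1; rewrite mul1r.
  by rewrite raddf0 mulmx0.
by move=> annb anng [kerW kerD]; split; apply: half.
Qed.

(** Every finitely generated submodule of R^n is one half of an exact 2-periodic
    complex of square matrices.  An entry g of A dividing all others is moved to
    the first column and used to clear its row, so up to an automorphism V of
    R^n the row space splits as R g plus a row space in R^(n - 1). *)
Lemma periodic_presentation n k (A : 'M[R]_(k, n)) :
  exists D W : 'M[R]_n,
    (forall x : 'rV_n, (exists y, x = y *m A) <-> exists y, x = y *m D) /\
    periodic_pair D W.
Proof.
elim: n k A => [|n IHn] k A.
  exists 0, 0; split=> [x|]; last split=> x.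
  - by split=> _; exists 0; rewrite !thinmx0.
  - by split=> _; [exists 0|]; rewrite !thinmx0.
  - by split=> _; [exists 0|]; rewrite !thinmx0.
have [->|A0] := eqVneq A 0.
  exists 0, 1%:M; split=> [x|].
    by split=> -[y ->]; exists 0; rewrite !mulmx0.
  split=> x; rewrite ?mulmx1 ?mulmx0.
    by split=> [->|[y ->]]; [exists 0 |]; rewrite mulmx0.
  by split=> // _; exists x; rewrite mulmx1.
have [ij0 Aij0] : exists ij, A ij.1 ij.2 != 0.
  apply: contrapT => Aij; case/eqP: A0; apply/matrixP => i j; rewrite mxE.
  by apply/eqP; apply: contra_notT Aij => ?; exists (i, j).
have [|[i0 j0] _ divA] := divisor_of_all (fun ij => A ij.1 ij.2) val
    (s := enum (('I_k * 'I_n.+1)%type : finType)).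
  by move=> e; have := mem_enum (('I_k * 'I_n.+1)%type : finType) ij0; rewrite e.
have /choice[q qE] (ij : 'I_k * 'I_n.+1) := divA ij (mem_enum _ _).
(* A' is A divided by g; the entry at the pivot is forced to be 1, since
   g = q g alone need not give q = 1. *)
pose A' : 'M[R]_(k, 1 + n) := \matrix_(i, j) if (i, j) == (i0, j0) then 1 else q (i, j).
pose g := A i0 j0.
have AE : A = g *: A'.
  apply/matrixP => i j; rewrite !mxE; case: eqP => [[-> ->]|_]; first by rewrite mulr1.
  by rewrite (qE (i, j)) mulrC.
have [|V [V' [VV' V'V rV]]] := @unimodular_row n (row i0 A') j0.
  by rewrite !mxE eqxx.
pose B := A' *m V.
have rB : row i0 B = row_mx 1%:M 0 by rewrite row_mul.
have [D1 [W1 [imD1 D1W1]]] := IHn k (g *: rsubmx B).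
have [b [annb anng]] := dann g.
have [kerF kerE] := periodic_pair_block annb anng D1W1.
set E := block_mx _ _ _ D1 in kerF kerE; set F := block_mx _ _ _ W1 in kerF kerE.
have imE (x : 'rV_(1 + n)) : (exists y, x = y *m (A *m V)) <-> exists y, x = y *m E.
  have AV (y : 'rV_k) : y *m (A *m V) =
      row_mx (g *: (y *m lsubmx B)) (y *m (g *: rsubmx B)).
    by rewrite AE -scalemxAl -!scalemxAr -/B -{1}[B]hsubmxK mul_mx_row scale_row_mx.
  split=> [[y ->]|[y ->]].
    have [|z yz] := (imD1 (y *m (g *: rsubmx B))).1; first by exists y.
    exists (row_mx (y *m lsubmx B) z); rewrite AV mul_row_block !mulmx0 addr0 add0r.
    by rewrite mul_mx_scalar yz.
  rewrite -[y]hsubmxK mul_row_block !mulmx0 addr0 add0r mul_mx_scalar.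
  have [|z ->] := (imD1 (rsubmx y *m D1)).2; first by exists (rsubmx y).
  exists (z + (lsubmx y - z *m lsubmx B) *m delta_mx 0 i0); rewrite mulmxDl -mulmxA -rowE.
  have -> : row i0 (A *m V) = row_mx g%:M 0.
    by rewrite AE -scalemxAl linearZ /= rB scale_row_mx scaler0 scalemx1.
  rewrite AV mul_mx_row mulmx0 add_row_mx addr0 mul_mx_scalar -scalerDr addrC.
  by rewrite subrK.
exists (E *m V'), (V *m F); split=> [x|]; last split=> x.
- split=> [[y xy]|[y xy]].
    have [|z yz] := (imE (y *m (A *m V))).1; first by exists y.
    by exists z; rewrite mulmxA -yz xy -!mulmxA VV' mulmx1.
  have [|z yz] := (imE (y *m E)).2; first by exists y.
  by exists z; rewrite xy mulmxA yz -!mulmxA VV' mulmx1.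
- rewrite mulmxA kerF; split=> -[y xy]; exists y.
    by rewrite mulmxA -xy -mulmxA VV' mulmx1.
  by rewrite xy -!mulmxA V'V mulmx1.
rewrite mulmxA; split=> [xE|[y ->]].
  have /kerE[y ->] : x *m E = 0 by rewrite -[LHS]mulmx1 -V'V mulmxA xE mul0mx.
  by exists (y *m V'); rewrite mulmxA -[_ *m V' *m V]mulmxA V'V mulmx1.
suff -> : y *m (V *m F) *m E = 0 by rewrite mul0mx.
by apply/kerE; exists (y *m V); rewrite mulmxA.
Qed.

Lemma finitely_presented_two_periodic (M : lmodType R) :
  finitely_presented M -> two_periodic M.
Proof.
move=> [m [n [d [p [exd p_surj]]]]].
have [D [W [imD [kerW kerD]]]] := periodic_presentation (lin1_mx d).
have ker_p x : p x = 0 <-> exists y, x = y *m D.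
  rewrite -imD; split=> [/exd[y <-]|[y ->]]; first by exists y; rewrite mul_rV_lin1.
  by apply/exd; exists y; rewrite mul_rV_lin1.
have [|i iE] := @factor_through_surj R _ _ _ p
    (mulmxr W : {linear 'rV_n -> 'rV_n}) p_surj.
  by move=> x /ker_p/kerW.
exists 'rV[R]_n, 'rV[R]_n, i, (mulmxr D), p.
split; first by split; apply: row_mod_projective.
split=> //.
- move=> x y; have [u <-] := p_surj x; have [v <-] := p_surj y; rewrite !iE /= => uv.
  apply/eqP; rewrite -subr_eq0 -linearB; apply/eqP/ker_p/kerW.
  by rewrite mulmxBl uv subrr.
- move=> y; rewrite /= kerD; split=> [[x ->]|[x <-]]; first by exists (p x); rewrite iE.
  by have [u <-] := p_surj x; exists u; rewrite iE.
- by move=> y; rewrite ker_p; split=> -[x]; exists x.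
Qed.

End PeriodicPresentation.

(** * Flat modules over a valuation ring *)

Section MatrixAction.
Variables (R : comNzRingType) (F : lmodType R).

Definition mx_act m n (A : 'M[R]_(m, n)) (z : 'I_n -> F) (i : 'I_m) : F :=
  \sum_j A i j *: z j.

Lemma mx_actM m n p (A : 'M[R]_(m, n)) (B : 'M[R]_(n, p)) z i :
  mx_act (A *m B) z i = mx_act A (mx_act B z) i.
Proof.
rewrite /mx_act; under eq_bigr do rewrite mxE scaler_suml.
rewrite exchange_big; apply: eq_bigr => j _; rewrite scaler_sumr.
by apply: eq_bigr => k _; rewrite scalerA.
Qed.

Lemma mx_act1 n (z : 'I_n -> F) i : mx_act 1%:M z i = z i.
Proof.
rewrite /mx_act (bigD1 i) //= mxE eqxx scale1r big1 ?addr0 // => j ji.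
by rewrite mxE eq_sym (negPf ji) scale0r.
Qed.

Lemma eq_mx_act m n (A : 'M[R]_(m, n)) (z z' : 'I_n -> F) i :
  z =1 z' -> mx_act A z i = mx_act A z' i.
Proof. by move=> zz'; apply: eq_bigr => j _; rewrite zz'. Qed.

(** The kernel of multiplication by a on F is no larger than (0 : a) F.  Over a
    valuation ring the elements of (0 : a) F are single products, and this
    property is flatness. *)
Definition torsion_divisible : Prop := forall (a : R) (z : F),
  a *: z = 0 -> exists b z', z = b *: z' /\ b * a = 0.

(** A triple (c, x, y) stands for the relation expressing c x + y linearly in x
    and y. *)
Definition respects (L : seq (R * F * F)) (h : F -> R) : Prop :=
  forall t, t \in L -> h (t.1.1 *: t.1.2 + t.2) = t.1.1 * h t.1.2 + h t.2.

Lemma respects_cat L1 L2 h :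
  respects (L1 ++ L2) h -> respects L1 h /\ respects L2 h.
Proof. by move=> hL; split=> t tL; apply: hL; rewrite mem_cat tL ?orbT. Qed.

(** Only finitely many elements z_j occur in L and X.  On them the triples of L
    become the rows of a matrix A of relations, and a column v with A v = 0 is
    the same as an assignment of values to the z_j that is compatible with L; it
    is extended by 0 to the rest of F. *)
Lemma finite_relations (L : seq (R * F * F)) (X : seq F) :
  exists n m (A : 'M[R]_(m, n)) (z : 'I_n -> F) (e : F -> 'rV[R]_n),
    [/\ forall i, mx_act A z i = 0,
        forall x, x \in X -> mx_act (e x) z 0 = x
      & forall v : 'cV_n, A *m v = 0 -> respects L (fun x => (e x *m v) 0 0)].
Proof.
pose lhs (t : R * F * F) := t.1.1 *: t.1.2 + t.2.
pose s := X ++ flatten [seq [:: lhs t; t.1.2; t.2] | t <- L].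
pose z (j : 'I_(size s)) := s`_j.
pose e x : 'rV[R]_(size s) := \row_j (nat_of_ord j == index x s)%:R.
pose l (i : 'I_(size L)) := nth (0, 0, 0) L i.
pose A := \matrix_i ((l i).1.1 *: e (l i).1.2 + e (l i).2 - e (lhs (l i))).
have eP x : x \in s -> mx_act (e x) z 0 = x.
  rewrite -index_mem => xs; rewrite /mx_act (bigD1 (Ordinal xs)) //= !mxE eqxx scale1r.
  rewrite /z /= nth_index -?index_mem // big1 ?addr0 // => j.
  by rewrite -val_eqE /= => /negPf jx; rewrite mxE jx scale0r.
have sL t : t \in L -> [/\ lhs t \in s, t.1.2 \in s & t.2 \in s].
  move=> tL; have sub x : x \in [:: lhs t; t.1.2; t.2] -> x \in s.
    by move=> xt; rewrite mem_cat; apply/orP; right; apply/flattenP;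
       exists [:: lhs t; t.1.2; t.2] => //; apply/mapP; exists t.
  by split; apply: sub; rewrite !inE eqxx ?orbT.
exists (size s), (size L), A, z, e; split=> [i|x xX|v Av t tL].
- have [] := sL (l i); first by rewrite mem_nth.
  move=> /eP lE /eP xE /eP yE.
  have -> : mx_act A z i = (l i).1.1 *: mx_act (e (l i).1.2) z 0
              + mx_act (e (l i).2) z 0 - mx_act (e (lhs (l i))) z 0.
    rewrite /mx_act scaler_sumr -big_split -sumrB; apply: eq_bigr => j _ /=.
    by rewrite !mxE scalerBl scalerDl scalerA.
  by rewrite lE xE yE subrr.
- by apply: eP; rewrite mem_cat xX.
have tn : (index t L < size L)%N by rewrite index_mem.
have lt : l (Ordinal tn) = t by rewrite /l /= nth_index.
have /matrixP/(_ 0 0) : row (Ordinal tn) A *m v = 0 by rewrite -row_mul Av row0.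
rewrite rowK lt !(mulmxDl, mulNmx) -scalemxAl.
set p := e t.1.2 *m v; set q := e t.2 *m v; set r := e (lhs t) *m v.
by rewrite !mxE => /eqP; rewrite subr_eq0 => /eqP.
Qed.

End MatrixAction.

(** The equational criterion for flatness.  A relation a z = 0 has the form
    g (a' z) = 0 with some entry of a' equal to 1; then a' z = b w with b g = 0,
    and that entry can be solved for.  Several relations are treated one after
    the other. *)
Lemma relations_factor (R : comNzRingType) (F : lmodType R) :
    (forall a b : R, divides a b \/ divides b a) -> torsion_divisible F ->
  forall m n (A : 'M[R]_(m, n)) (z : 'I_n -> F), (forall i, mx_act A z i = 0) ->
  exists k (C : 'M[R]_(n, k)) (y : 'I_k -> F),
    (forall j, z j = mx_act C y j) /\ A *m C = 0.
Proof.
move=> val tdF.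
have one_relation n (a : 'rV[R]_n) (z : 'I_n -> F) : mx_act a z 0 = 0 ->
    exists k (C : 'M[R]_(n, k)) (y : 'I_k -> F),
      (forall j, z j = mx_act C y j) /\ a *m C = 0.
  move=> az; have [->|a0] := eqVneq a 0.
    by exists n, 1%:M, z; split=> [j|]; rewrite ?mx_act1 ?mul0mx.
  have [j1 aj1] : exists j, a 0 j != 0.
    apply: contrapT => aj; case/eqP: a0; apply/rowP => j; rewrite mxE.
    by apply/eqP; apply: contra_notT aj => ?; exists j.
  have [|j0 _ diva] := divisor_of_all (fun j => a 0 j) val (s := enum 'I_n).
    by move=> e; have := mem_enum 'I_n j1; rewrite e.
  have /choice[q qE] (j : 'I_n) := diva j (mem_enum _ _).
  pose g := a 0 j0; pose a' : 'rV[R]_n := \row_j if j == j0 then 1 else q j.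
  have aE : a = g *: a'.
    by apply/rowP => j; rewrite !mxE; case: eqP => [->|_]; rewrite ?mulr1 // qE mulrC.
  have [b [w [wE bg]]] : exists b w, mx_act a' z 0 = b *: w /\ b * g = 0.
    apply: tdF; rewrite -az aE /mx_act scaler_sumr.
    by apply: eq_bigr => j _; rewrite !mxE scalerA.
  (* Up to the multiple b w of the unit vector at j0, z is the image of itself
     under 1 - delta a', which the row a kills. *)
  pose y (j : 'I_(n + 1)) := match fintype.split j with inl j => z j | inr _ => w end.
  exists (n + 1)%N, (row_mx (1%:M - delta_mx j0 0 *m a') (b *: delta_mx j0 0)), y.
  split=> [j|]; last first.
    rewrite mul_mx_row mulmxBr mulmx1 mulmxA -scalemxAr -colE.
    have -> : col j0 a = g%:M by rewrite [LHS]mx11_scalar mxE.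
    by rewrite mul_scalar_mx -aE subrr scale_scalar_mx bg raddf0 row_mx0.
  rewrite /mx_act big_split_ord big_ord1 /=.
  under eq_bigr do rewrite row_mxEl /y (unsplitK (inl _)).
  rewrite row_mxEr /y (unsplitK (inr _)).
  under eq_bigr do rewrite mxE scalerDl.
  rewrite big_split /= -/(mx_act 1%:M z j) mx_act1 -addrA -[LHS]addr0.
  congr (_ + _); apply/esym.
  have -> : \sum_i (- (delta_mx j0 0 *m a' : 'M_n)) j i *: z i =
      - ((j == j0)%:R *: (b *: w)).
    rewrite -wE /mx_act scaler_sumr -sumrN; apply: eq_bigr => i _.
    by rewrite mxE mxE big_ord1 !mxE eqxx andbT scaleNr scalerA.
  by rewrite !mxE eqxx andbT !scalerA [b * _]mulrC addNr.
elim=> [|m IHm] n A z Az.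
  exists n, 1%:M, z; split=> [j|]; first by rewrite mx_act1.
  by rewrite mulmx1 [LHS]flatmx0.
pose A1 : 'rV_n := usubmx (A : 'M_(1 + m, n)); pose A2 := dsubmx (A : 'M_(1 + m, n)).
have [|k [C1 [y1 [zE A1C1]]]] := one_relation n A1 z.
  by rewrite -[RHS](Az (lshift m (0 : 'I_1))); apply: eq_bigr => j _; rewrite mxE.
have [|l [C2 [y2 [y1E A2C]]]] := IHm k (A2 *m C1) y1.
  move=> i; rewrite mx_actM -[RHS](Az (rshift 1 i)).
  by apply: eq_bigr => j _; rewrite mxE -zE.
exists l, (C1 *m C2), y2; split=> [j|].
  by rewrite zE mx_actM; apply: eq_mx_act.
rewrite -[A in LHS](vsubmxK (A : 'M_(1 + m, n))).
rewrite [LHS](mul_col_mx A1 A2) !mulmxA A1C1 A2C.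
by rewrite mul0mx col_mx0.
Qed.

Section Tensors.
Variable R : comNzRingType.
Implicit Types M N F : lmodType R.

Lemma freeg_sum_pure M F (u : pair_mod M F) :
  u = \sum_(p <- dom u) coeff p u *: pure p.1 p.2.
Proof.
rewrite -[LHS]freeg_sumE; apply: eq_bigr => -[x y] _.
apply/eqP/freeg_eqP => p; rewrite coeffZ /pure !coeffU /=.
by rewrite mul1r.
Qed.

(** A formal sum that vanishes in N (x) F does so because of finitely many
    bilinearity relations.  A map h : F -> R compatible with those in the second
    variable therefore induces a map to N that kills the formal sum; the ones in
    the first variable are killed by any h. *)
Lemma tensor_rel_relations N F (u : pair_mod N F) : u \in @tensor_rel R N F ->
  exists L, forall h, respects L h -> fglift (fun p => h p.2 *: p.1) u = 0.
Proof.
pose lift h := fglift (fun p : N * F => h p.2 *: p.1).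
have liftP (h : F -> R) x y : lift h (pure x y) = h y *: x.
  by rewrite /lift liftU scale1r.
have [||S inS] := @submod_exists R (pair_mod N F)
    (fun u => exists L, forall h, respects L h -> lift h u = 0).
- exists [::] => h _.
  have [g gE] := linear_exists (fglift_linear (fun p : N * F => h p.2 *: p.1)).
  by rewrite /lift -gE linear0.
- move=> c v w [L1 L1P] [L2 L2P]; exists (L1 ++ L2) => h /respects_cat[hL1 hL2].
  by rewrite /lift fglift_linear [fglift _ v]L1P // [fglift _ w]L2P // scaler0 addr0.
move=> /asboolP/(_ S) uS; apply/inS/uS.
have liftB h v w : lift h (v - w) = lift h v - lift h w.
  have [g gE] := linear_exists (fglift_linear (fun p : N * F => h p.2 *: p.1)).
  by rewrite /lift -!gE linearB.
split=> [c x x' y|c x y y']; apply/inS.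
  exists [::] => h _; rewrite liftB [lift h (_ + _)]fglift_linear -!/(lift _ _) !liftP.
  by rewrite scalerDr !scalerA mulrC subrr.
exists [:: (c, y, y')] => h /(_ _ (mem_head _ _)) /= hc.
rewrite liftB [lift h (_ + _)]fglift_linear -!/(lift _ _) !liftP hc.
by rewrite scalerDl scalerA subrr.
Qed.

(** Suppose that f sends u = sum m_p (x) x_p to 0.  Only finitely many relations
    in F are involved, so by the equational criterion
    x_p = sum_j h_j(x_p) y_j for maps h_j respecting them.  Applying h_j to the
    image of u gives f (sum_p h_j(x_p) m_p) = 0, hence sum_p h_j(x_p) m_p = 0 for
    each j, and u = sum_j (sum_p h_j(x_p) m_p) (x) y_j = 0. *)
Lemma flat_of_torsion_divisible F :
    (forall a b : R, divides a b \/ divides b a) -> torsion_divisible F -> flat F.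
Proof.
move=> val tdF M N f f_inj.
have flin : linear (tensor_map (F := F) f).
  by apply: tensor_lift_linear => [y c x x'|x c y y']; rewrite ?linearP;
    [apply: tens_linearl | apply: tens_linearr].
have [tf tfE] := linear_exists flin.
suff ker0 t : tf t = 0 -> t = 0.
  move=> t t'; rewrite -!tfE => tt'; apply/eqP; rewrite -subr_eq0; apply/eqP/ker0.
  by rewrite linearB tt' subrr.
have [u <-] := quot_pi_surj t; rewrite tfE => fu0.
have pi_sum (M' : lmodType R) (v : seq (M * F)) (c : M * F -> R) (g : M -> M') :
    quot_pi (@tensor_rel R M' F) (\sum_(p <- v) c p *: pure (g p.1) p.2) =
    \sum_(p <- v) c p *: tens (g p.1) p.2.
  by rewrite linear_sum; apply: eq_bigr => p _; rewrite linearZ.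
have piE : quot_pi (@tensor_rel R M F) u = \sum_(p <- dom u) coeff p u *: tens p.1 p.2.
  by rewrite -(pi_sum M _ _ id) -freeg_sum_pure.
pose fu := \sum_(p <- dom u) coeff p u *: pure (f p.1) p.2.
have /tensor_rel_relations[L LP] : fu \in @tensor_rel R N F.
  apply/quot_pi_eq0; rewrite pi_sum -[RHS]fu0 piE -tfE linear_sum; apply: eq_bigr => p _.
  by rewrite linearZ /= tfE tensor_mapE.
have [n [m [A [z [e [Az eX hL]]]]]] := finite_relations L [seq p.2 | p <- dom u].
have [k [C [y [zE AC]]]] := relations_factor val tdF Az.
pose h j x := (e x *m C) 0 j.
have h_dom p : p \in dom u -> p.2 = \sum_j h j p.2 *: y j.
  move=> pu; rewrite -[LHS]eX ?map_f // (eq_mx_act _ _ zE) -mx_actM.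
  by apply: eq_bigr => j _.
have hu0 j : \sum_(p <- dom u) coeff p u *: (h j p.2 *: p.1) = 0.
  apply: f_inj; rewrite linear0 -[RHS](LP (h j)).
    have [g gE] := linear_exists (fglift_linear (fun p : N * F => h j p.2 *: p.1)).
    rewrite -gE !linear_sum; apply: eq_bigr => p _.
    by rewrite !linearZ /= gE liftU scale1r.
  have -> : h j = fun x => (e x *m col j C) 0 0.
    by apply/funext => x; rewrite colE mulmxA -colE mxE.
  by apply: hL; rewrite colE mulmxA AC mul0mx.
have tl (x' : F) : exists g : {linear M -> tensor M F}, forall x, g x = tens x x'.
  exact: (linear_exists (@tens_linearl R M F x')).
have tr (x : M) : exists g : {linear F -> tensor M F}, forall x', g x' = tens x x'.
  exact: (linear_exists (@tens_linearr R M F x)).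
rewrite piE big_seq.
have -> : \sum_(p <- dom u | p \in dom u) coeff p u *: tens p.1 p.2 =
          \sum_(p <- dom u | p \in dom u) \sum_j tens (coeff p u *: (h j p.2 *: p.1)) (y j).
  apply: eq_bigr => p pu; have [g gE] := tr p.1; rewrite {1}(h_dom p pu) -gE.
  rewrite linear_sum scaler_sumr; apply: eq_bigr => j _; rewrite linearZ /= gE.
  have [g' g'E] := tl (y j); rewrite -!g'E.
  by rewrite [RHS]linearZ /= [g' (_ *: _)]linearZ.
rewrite -big_seq exchange_big big1 // => j _; have [g gE] := tl (y j).
by rewrite -[RHS](linear0 g) -(hu0 j) linear_sum; apply: eq_bigr => p _; rewrite gE.
Qed.

End Tensors.

(** Multiplication by a embeds R/(0 : a) in R and sends 1 (x) z to a (x) z = 0.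
    So 1 (x) z = 0 in R/(0 : a) (x) F, which maps to F/(0 : a)F.  Elements of
    (0 : a)F are single products b z', as two elements of R have one dividing the
    other. *)
Lemma flat_torsion_divisible (R : comNzRingType) (F : lmodType R) :
    (forall a b : R, divides a b \/ divides b a) -> flat F -> torsion_divisible F.
Proof.
move=> val Fflat a z az.
have [||S inS] := @submod_exists R F (fun y => exists b y', y = b *: y' /\ b * a = 0).
- by exists 0, 0; rewrite scaler0 mul0r.
- move=> c _ _ [b1 [y1 [-> b1a]]] [b2 [y2 [-> b2a]]].
  case: (val b1 b2) => -[d ->].
    by exists b1, (c *: y1 + d *: y2); rewrite scalerDr !scalerA [c * b1]mulrC [d * b1]mulrC.
  by exists b2, ((c * d) *: y1 + y2); rewrite scalerDr !scalerA [b2 * (c * d)]mulrC mulrA.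
apply/inS/quot_pi_eq0.
pose one : quot_mod (ann a) := quot_pi (ann a) (1 : R^o).
have [mu muE] : exists mu : {linear quot_mod (ann a) -> R^o},
    forall r, mu (quot_pi (ann a) r) = (r * a : R).
  have [|f fE] := @linear_exists R R^o R^o (fun r : R => r * a).
    by move=> c u v; rewrite mulrDl -[c *: u * a]mulrA.
  have [|mu muE] := @factor_through_surj R _ _ _ (quot_pi (ann a)) f
    (quot_pi_surj (S := ann a)).
    by move=> v va; rewrite fE; apply/eqP/(quot_pi_eq0 (ann a) v).
  by exists mu => r; rewrite muE fE.
have mu_inj : injective mu.
  move=> x y; have [r <-] := quot_pi_surj x; have [s <-] := quot_pi_surj y.
  rewrite !muE => rs; apply/quot_piP/eqP.
  by rewrite [LHS]mulrBl; apply/eqP; rewrite subr_eq0; apply/eqP.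
have tens0 (N : lmodType R) : @tens R N F 0 z = 0.
  by have [g gE] := linear_exists (@tens_linearl R N F z); rewrite -gE linear0.
have one_z : tens one z = tens 0 z.
  apply: (Fflat _ _ mu mu_inj); rewrite !tensor_mapE muE linear0 tens0 mul1r.
  have [g gE] := linear_exists (@tens_linearl R R^o F z).
  have [g' g'E] := linear_exists (@tens_linearr R R^o F 1).
  have -> : a = a *: (1 : R^o) by rewrite /GRing.scale /= mulr1.
  by rewrite -gE linearZ /= gE -g'E -linearZ /= az linear0.
have /choice[G GE] (y : F) : exists g : {linear quot_mod (ann a) -> quot_mod S},
    forall r : R, g (quot_pi (ann a) (r : R^o)) = quot_pi S (r *: y).
  have [|f fE] := @linear_exists R R^o (quot_mod S) (fun r => quot_pi S ((r : R) *: y)).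
    by move=> c u v; rewrite -linearP scalerDl scalerA.
  have [|g gE] := @factor_through_surj R _ _ _ (quot_pi (ann a)) f
    (quot_pi_surj (S := ann a)).
    move=> r /quot_pi_eq0/eqP ra; rewrite fE; apply/quot_pi_eq0/inS.
    by exists r, y.
  by exists g => r; rewrite gE fE.
have Gl y : linear (fun q => G y q) by move=> c u v; rewrite linearP.
have Gr q : linear (fun y => G y q).
  have [r <-] := quot_pi_surj q; move=> c u v; rewrite !GE -linearP.
  by rewrite scalerDr !scalerA mulrC.
have := tensor_liftE Gl Gr one z; rewrite one_z (tensor_liftE Gl Gr).
by rewrite linear0 GE scale1r.
Qed.

(** * Embedding modules in flat modules *)

Section SemiregularValuation.
Variables (R : comNzRingType).
Hypothesis val : forall a b : R, divides a b \/ divides b a.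
Hypothesis dann : forall c : R, exists b, generates_ann c b /\ generates_ann b c.

(** The kernel of W is the row space of the relation matrix A, so the columns of
    W respect L and some column is nonzero at m. *)
Lemma finite_separation (M : lmodType R) (L : seq (R * M * M)) (m : M) : m != 0 ->
  exists2 h : M -> R, respects L h & h m != 0.
Proof.
move=> m0; have [n [k [A [z [e [Az eX hL]]]]]] := finite_relations L [:: m].
have [D [W [imD [kerW _]]]] := periodic_presentation val dann A.
have [j hj] : exists j, (e m *m W) 0 j != 0.
  apply: contrapT => eW0.
  have /kerW/imD[y ey] : e m *m W = 0.
    apply/rowP => j; rewrite [RHS]mxE; apply/eqP.
    by apply: contra_notT eW0 => ?; exists j.
  case/eqP: m0; rewrite -(eX m) ?mem_head // ey mx_actM.
  by rewrite /mx_act big1 // => i _; rewrite -/(mx_act A z i) Az scaler0.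
exists (fun x => (e x *m col j W) 0 0); last by rewrite colE mulmxA -colE mxE.
apply: hL; have AW : A *m W = 0.
  apply/row_matrixP => i; rewrite row_mul row0; apply/kerW/imD.
  by exists (delta_mx 0 i); rewrite rowE.
by rewrite colE mulmxA AW mul0mx.
Qed.

(** The flat module is a reduced power of R whose index set consists of all
    functions h : M -> R, filtered by the sets of those respecting a given finite
    family of relations; M embeds by evaluation.  If a kills the class of z, then
    a z(h) = 0 for all h in a set of the filter, hence z(h) is a multiple of the
    generator b of (0 : a) there. *)
Lemma valuation_semiregular : semiregular R.
Proof.
move=> M; pose F0 : lmodType R := ((M -> R) -> R^o)%type.
have [||S inS] := @submod_exists R F0
    (fun z => exists L, forall h, respects L h -> z h = 0).
- by exists [::].
- move=> c u v [L1 uP] [L2 vP]; exists (L1 ++ L2) => h /respects_cat[hL1 hL2].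
  by rewrite -[LHS]/(c * u h + v h) (uP h) // (vP h) // mulr0 addr0.
exists (quot_mod S).
  apply: (flat_of_torsion_divisible val) => a x.
  have [z <-] := quot_pi_surj x; rewrite -linearZ => /quot_pi_eq0/inS[L azL].
  have [b [annb _]] := dann a.
  have /choice[z' z'E] (h : M -> R) : exists c : R, respects L h -> z h = c * b.
    have [hL|] := pselect (respects L h); last by exists 0.
    have /annb[c zc] : (z h : R) * a = 0 by rewrite mulrC; apply: azL.
    by exists c => _; exact: zc.
  exists b, (quot_pi S (z' : F0)); split; last by apply/annb; exists 1; rewrite mul1r.
  rewrite -linearZ; apply/quot_piP/inS; exists L => h hL.
  rewrite -[LHS]/(z h - b * z' h) z'E // mulrC subrr //.
have [|j jE] := @linear_exists R M (quot_mod S)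
    (fun m => quot_pi S ((fun h => h m) : F0)).
  move=> c x y; rewrite -linearP; apply/quot_piP/inS.
  exists [:: (c, x, y)] => h /(_ _ (mem_head _ _)) /= hxy.
  by rewrite -[LHS]/(h (c *: x + y) - (c * h x + h y)) hxy subrr.
exists j => x y jxy; apply/eqP; rewrite -subr_eq0; apply: contra_eqT jxy => xy0.
rewrite -subr_eq0 -linearB jE; apply/eqP => /quot_pi_eq0/inS[L zL].
have [h hL] := finite_separation L xy0.
by rewrite [h _]zL ?eqxx.
Qed.

End SemiregularValuation.

(** * The equivalences *)

Section LocalRing.
Variables (R : comNzRingType) (P : submodClosed R^o).
Hypothesis P_local : unique_maximal_ideal P.

(** Let z0 be the image in a flat module of the generator of R/(a), for a
    nonzero a in P.  From a z0 = 0 follows z0 = b z with b a = 0, so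
    (0 : b) lies in (0 : z0) = (a), and in fact (0 : b) = (a). *)
Lemma semiregular_annihilator : ~ is_field R ->
    (forall a b : R, divides a b \/ divides b a) -> semiregular R ->
  exists2 a : R, a != 0 &
    (exists2 r : R, r \in ann a & r != 0) /\ fg_ideal (ann a).
Proof.
move=> /(nonfield_local P_local)[a a0 aP] val semi; have [S inS] := principal_submod a.
have [F Fflat [f f_inj]] := semi (quot_mod S).
pose z0 := f (quot_pi S (1 : R^o)).
have z0E (r : R) : r *: z0 = f (quot_pi S (r : R^o)).
  have rE : (r : R^o) = r *: (1 : R^o) by rewrite /GRing.scale /= mulr1.
  by rewrite [in RHS]rE /z0 !linearZ.
have z0_eq0 r : r *: z0 = 0 <-> divides a r.
  rewrite z0E; split=> [fr0|/inS/quot_pi_eq0->]; last exact: linear0.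
  by apply/inS/quot_pi_eq0/f_inj; rewrite fr0 linear0.
have [|b [z [z0b ba]]] := flat_torsion_divisible val Fflat (a := a) (z := z0).
  by apply/z0_eq0; exists 1; rewrite mul1r.
have annb r : r \in ann b <-> divides a r.
  split=> [/eqP rb|[c ->]]; first by apply/z0_eq0; rewrite z0b scalerA rb scale0r.
  by apply/eqP; rewrite -mulrA [a * b]mulrC ba mulr0.
exists b; last split.
- apply/eqP => b0; have [|c c1] := (z0_eq0 1).1; first by rewrite z0b b0 scale0r scaler0.
  by have := local_not1 P_local; rewrite c1 idealM.
- by exists a => //; apply/annb; exists 1; rewrite mul1r.
exists [:: a] => r; rewrite annb; split=> [[c ->]|[c ->]].
  by exists (fun=> c); rewrite big_ord1.
by exists (c 0); rewrite big_ord1.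
Qed.

(** Let (0 : a) = (b).  If P were flat, b a = 0 would give b = c p with p in P
    and c in (0 : a) = (b), so that b is in P b. *)
Lemma maximal_ideal_not_flat (a b : R) :
    (forall a b : R, divides a b \/ divides b a) ->
    a != 0 -> b != 0 -> generates_ann a b -> ~ flat (submod_of P).
Proof.
move=> val a0 b0 annb Pflat; have ba : b * a = 0 by apply/annb; exists 1; rewrite mul1r.
have bP : b \in P.
  apply/negPn/negP => /(local_unit P_local)[u ub]; case/eqP: a0.
  by rewrite -[a]mul1r -ub -mulrA ba mulr0.
have [|c [p [bE /annb[d cd]]]] :=
    flat_torsion_divisible val Pflat (a := a) (z := Submod bP).
  by apply/val_inj; rewrite linearZ /=; apply: etrans ba; apply: mulrC.
case/eqP: b0; apply: (local_cancel P_local (idealM d (submod_valP p))).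
have /(congr1 \val) := bE; rewrite linearZ /= => b_cp.
by rewrite {1}b_cp cd /GRing.scale /= mulrAC.
Qed.

(** If (a, b) = (g), a = a' g, b = b' g and neither a' nor b' is a unit, then g
    is in P g and vanishes. *)
Lemma bezout_valuation : bezout_ring R -> forall a b : R, divides a b \/ divides b a.
Proof.
move=> bez a b.
have [||I inI] := @submod_exists R R^o (fun x => exists c d : R, x = c * a + d * b).
- by exists 0, 0; rewrite !mul0r addr0.
- move=> k _ _ [c [d ->]] [c' [d' ->]]; exists (k * c + c'), (k * d + d').
  by rewrite !mulrDl addrACA -!mulrA -mulrDr.
have [|g gI] := bez I.
  exists [:: a; b] => x; rewrite inI; split=> [[c [d ->]]|[c ->]].
    exists (fun i : 'I_2 => if i == ord0 then c else d).
    by rewrite big_ord_recl big_ord1.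
  exists (c (ord0 : 'I_2)), (c (fintype.lift (ord0 : 'I_2) ord0)).
  by rewrite big_ord_recl big_ord1.
have /gI[a' aE] : a \in I by apply/inI; exists 1, 0; rewrite mul1r mul0r addr0.
have /gI[b' bE] : b \in I by apply/inI; exists 0, 1; rewrite mul1r mul0r add0r.
have /inI[c [d gE]] : g \in I by apply/gI; exists 1; rewrite mul1r.
have [a'P|/(local_unit P_local)[u ua]] := boolP (a' \in P); last first.
  by left; exists (b' * u); rewrite aE -mulrA [u * _]mulrA ua mul1r.
have [b'P|/(local_unit P_local)[u ub]] := boolP (b' \in P); last first.
  by right; exists (a' * u); rewrite bE -mulrA [u * _]mulrA ub mul1r.
have g0 : g = 0.
  apply: (local_cancel P_local (idealD (idealM c a'P) (idealM d b'P))).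
  by rewrite mulrDl -!mulrA -aE -bE.
by left; exists 0; rewrite bE g0 mul0r mulr0.
Qed.

(** Suppose that no annihilator (0 : a) with a != 0 is nonzero and finitely
    generated, and let a x = 0 with x in P nonzero.  Then (0 : a) is not
    generated by x, so it contains some q with x = c q and c in P.  Reading x as
    q c displays it in (0 : a) P. *)
Lemma not_flat_annihilator :
    (forall a b : R, divides a b \/ divides b a) -> ~ flat (submod_of P) ->
  exists2 a : R, a != 0 &
    (exists2 r : R, r \in ann a & r != 0) /\ fg_ideal (ann a).
Proof.
move=> val; apply: contra_notP => none.
apply: flat_of_torsion_divisible => // a p ap.
have [->|a0] := eqVneq a 0; first by exists 1, p; rewrite scale1r mulr0.
have [->|p0] := eqVneq p 0; first by exists 0, 0; rewrite scaler0 mul0r.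
pose x : R := \val p.
have xa : x * a = 0 by have /(congr1 \val) := ap; rewrite linearZ mulrC.
have [q qa nxq] : exists2 q : R, q \in ann a & ~ divides x q.
  apply: contrapT => allx; apply: none; exists a => //; split.
    exists x; first exact/eqP.
    by apply: contra_neq p0 => x0; apply/val_inj.
  exists [:: x] => r; split=> [ra|[c ->]].
    have [c ->] : divides x r by apply: contrapT => nxr; apply: allx; exists r.
    by exists (fun=> c); rewrite big_ord1.
  by rewrite big_ord1 /=; apply: (idealM (I := ann a)); apply/eqP.
have [//|[c xE]] := val x q.
have cP : c \in P.
  apply/negPn/negP => /(local_unit P_local)[u uc]; apply: nxq.
  by exists u; rewrite xE mulrA uc mul1r.
exists q, (Submod cP); split; last exact/eqP.
by apply/val_inj; rewrite linearZ; apply: etrans xE _; exact: mulrC.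
Qed.

End LocalRing.

Theorem corollary4p4 (R : comNzRingType) (P : submodClosed R^o)
    (R_local : unique_maximal_ideal P) (R_not_field : ~ is_field R) :
  [<-> two_semiregular R;
       forall M : lmodType R,
         finitely_presented M -> cyclic_mod M -> two_periodic M;
       valuation_ring R /\ semiregular R;
       valuation_ring R /\
         (exists2 a : R, a != 0 &
            (exists2 r : R, r \in ann a & r != 0) /\ fg_ideal (ann a));
       bezout_ring R /\ ~ flat (submod_of P)].
Proof.
have val_ann_dann : valuation_ring R -> (exists2 a : R, a != 0 &
      (exists2 r : R, r \in ann a & r != 0) /\ fg_ideal (ann a)) ->
    forall c : R, exists b, generates_ann c b /\ generates_ann b c.
  move=> /valuation_ringP val [a a0 [[r ra r0] fga]].
  exact: (fg_ann_double_annihilator R_local val a0 ra r0 fga).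
tfae=> [two M fpM _|periodic|[val semi]|[val exa]|[bez nflat]].
- exact: two.
- have val : valuation_ring R.
    exact/valuation_ringP/(periodic_valuation R_local periodic).
  have dann := val_ann_dann val (periodic_annihilator R_local periodic R_not_field).
  by split=> //; apply: valuation_semiregular => //; apply/valuation_ringP.
- by split=> //; apply: semiregular_annihilator R_local _ _ _ => //; apply/valuation_ringP.
- have dann := val_ann_dann val exa; have /valuation_ringP val' := val.
  split; first exact: valuation_bezout.
  have [a a0 [[r ra r0] _]] := exa; have [b [annb _]] := dann a.
  apply: (maximal_ideal_not_flat R_local val' a0 _ annb).
  apply: contra_neq r0 => b0; have /annb[c ->] : r * a = 0 by apply/eqP.
  by rewrite b0 mulr0.
have val' := bezout_valuation R_local bez; have /valuation_ringP val := val'.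
have dann := val_ann_dann val (not_flat_annihilator R_local val' nflat).
by move=> M; apply: finitely_presented_two_periodic.
Qed.
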